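(* Let $R$ be a p.q.-Baer $*$-ring and let $a$ be a cut vertex of $\Gamma^*_s(R)$. Then $a$ is a central projection of $R$ and $a$ is an atom in the lattice $L(CP(R))$ of central projections of $R$.
   Context: A $*$-ring is a ring $R$ with an involution $x\mapsto x^*$. A projection is an element $e$ with $e^2=e=e^*$; a central projection is a projection in the centre of $R$, and $CP(R)$ is the set of them. $CP(R)$ is a lattice under $e\leq f$ iff $e=ef=fe$, with $e\wedge f=ef$, $e\vee f=e+f-ef$; an atom is a nonzero $e$ such that $0\leq f\leq e$ implies $f=0$ or $f=e$. For $S\subseteq R$, $r_R(S)=\{x\in R: sx=0\ \forall s\in S\}$. $R$ is a p.q.-Baer $*$-ring if for every $a\in R$, $r_R(aR)=eR$ for some projection $e\in R$. The strong zero-divisor graph $\Gamma^*_s(R)$ is the simple undirected graph with vertex set $\{0\neq a\in R: r_R(aR)\neq\{0\}\}$, distinct vertices $a,b$ adjacent iff $aRb^*=0$. A cut vertex is a vertex whose removal increases the number of connected components. *)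

(* Defs.v *)
From HB Require Import structures.
From Stdlib Require Import Relation_Operators.
From mathcomp Require Import all_boot ssralg.
From mathcomp Require Import boolp classical_sets functions cardinality.

Set Implicit Arguments.
Unset Strict Implicit.
Unset Printing Implicit Defensive.

Import GRing.Theory.
Local Open Scope ring_scope.
Local Open Scope classical_set_scope.
Local Open Scope card_scope.

(* Requiring a unit loses no p.q.-Baer *-ring: r(0R) = R = eR with e a
   projection forces e to be a two-sided unit. *)
HB.mixin Record isStarRing R of GRing.PzRing R := {
  star : R -> R;
  starK : involutive star;
  starD : {morph star : x y / x + y};
  starM : forall x y, star (x * y) = star y * star x
}.

#[short(type="starRingType")]
HB.structure Definition StarRing := {R of isStarRing R & GRing.PzRing R}.

Section StarRings.
Variable R : starRingType.
Implicit Types (a b e f x : R) (S : set R).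

Lemma star0 : star 0 = 0 :> R.
Proof. by apply: (addrI (star 0)); rewrite -starD !addr0. Qed.

Definition projection e : Prop := e * e = e /\ star e = e.

Definition central_projection e : Prop :=
  projection e /\ forall x, e * x = x * e.

Definition CP : set R := [set e | central_projection e].

Definition cp_le e f : Prop := e = e * f /\ e = f * e.

Definition cp_atom e : Prop :=
  [/\ CP e, e <> 0 &
      forall f, CP f -> cp_le 0 f -> cp_le f e -> f = 0 \/ f = e].

Definition rann S : set R := [set x | forall s, S s -> s * x = 0].

Definition rmulset a : set R := [set a * x | x in [set: R]].

Definition pq_Baer : Prop :=
  forall a, exists2 e, projection e & rann (rmulset a) = rmulset e.

End StarRings.

Record sgraph (T : Type) := SGraph {
  vertex : set T;
  edge : T -> T -> Prop;
  edge_vertex : forall x y, edge x y -> vertex x /\ vertex y;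
  edge_sym : forall x y, edge x y -> edge y x;
  edge_irr : forall x, ~ edge x x
}.

Section Graphs.
Variable T : Type.
Implicit Types (G : sgraph T) (v : T).

Definition del_edge G v (x y : T) : Prop := [/\ edge G x y, x <> v & y <> v].

Lemma del_edge_vertex G v x y :
  del_edge G v x y -> (vertex G `\ v) x /\ (vertex G `\ v) y.
Proof. by move=> [Gxy xv yv]; have [Vx Vy] := edge_vertex Gxy; split; split. Qed.

Lemma del_edge_sym G v x y : del_edge G v x y -> del_edge G v y x.
Proof. move=> [Gxy xv yv]; split=> //; exact: edge_sym. Qed.

Lemma del_edge_irr G v x : ~ del_edge G v x x.
Proof. by move=> [Gxx _ _]; apply: edge_irr Gxx. Qed.

Definition del_vertex G v : sgraph T :=
  SGraph (@del_edge_vertex G v) (@del_edge_sym G v) (@del_edge_irr G v).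

Definition component G (x : T) : set T :=
  [set y | clos_refl_trans T (edge G) x y].

Definition components G : set (set T) :=
  [set component G x | x in vertex G].

(* The set of components may be infinite, so "increases the number of
   components" is strict inequality of cardinals. *)
Definition cut_vertex G v : Prop :=
  [/\ vertex G v,
      components G #<= components (del_vertex G v) &
      ~ (components (del_vertex G v) #<= components G)].

End Graphs.

Section StrongZeroDivisorGraph.
Variable R : starRingType.

Definition szd_vertex : set R :=
  [set a | a <> 0 /\ rann (rmulset a) <> [set 0]].

Definition szd_edge (a b : R) : Prop :=
  [/\ szd_vertex a, szd_vertex b, a <> b & forall x, a * x * star b = 0].

Lemma szd_edge_vertex (a b : R) :
  szd_edge a b -> szd_vertex a /\ szd_vertex b.
Proof. by case. Qed.

Lemma szd_edge_sym (a b : R) : szd_edge a b -> szd_edge b a.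
Proof.
case=> Va Vb ab0 H; split=> // [ba|x]; first exact: ab0.
apply: (can_inj starK); rewrite star0 !starM starK mulrA; exact: H.
Qed.

Lemma szd_edge_irr (a : R) : ~ szd_edge a a.
Proof. by case. Qed.

Definition strong_zero_divisor_graph : sgraph R :=
  SGraph szd_edge_vertex szd_edge_sym szd_edge_irr.

End StrongZeroDivisorGraph.

(* Main.v *)
Require Import Defs.
From HB Require Import structures.
From mathcomp Require Import all_boot ssralg.
From mathcomp Require Import boolp classical_sets functions cardinality.
From Stdlib Require Import Relation_Operators.

(** In a p.q.-Baer *-ring the right annihilator of [xR] is generated by a
    central projection [e], and [x] is adjacent to every nonzero central
    projection below [e].  Let deleting [a] separate [x] from [y], with
    annihilator projections [e] and [f].  If [g] and [h] are nonzero central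
    projections below [e] and [f] which are equal or orthogonal, then
    [x - g - h - y] is a path, so [a] is [g] or [h].  If [e * f] is nonzero,
    take [g = h] below [e * f]: then [a] is the only nonzero central projection
    below [e * f].  If [e * f = 0], then any [g] and [h] are orthogonal, and
    [a] is the only nonzero central projection below [e] or below [f]. *)

Set Implicit Arguments.
Unset Strict Implicit.
Unset Printing Implicit Defensive.

Import GRing.Theory.
Local Open Scope ring_scope.
Local Open Scope classical_set_scope.
Local Open Scope card_scope.

Section Components.
Variable T : Type.
Implicit Types (G : sgraph T) (v x y z : T).

Lemma edge_component G x y : edge G x y -> component G x y.
Proof. exact: rt_step. Qed.

Lemma component_trans G x y z :
  component G x y -> component G y z -> component G x z.
Proof. exact: rt_trans. Qed.

Lemma component_sym G x y : component G x y -> component G y x.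
Proof.
move=> xy; elim: xy => [u w uw | u | u w z _ wu _ zw].
- exact/edge_component/edge_sym.
- exact: rt_refl.
- exact: component_trans zw wu.
Qed.

Lemma component_sub_vertex G x : vertex G x -> component G x `<=` vertex G.
Proof.
move=> Gx y xy; elim: xy Gx => // [u w uw _ | u w z _ IHw _ IHz Gu].
- by have [] := edge_vertex uw.
- exact/IHz/IHw.
Qed.

Lemma cut_vertex_separates G v : cut_vertex G v ->
  exists x y, [/\ vertex (del_vertex G v) x, vertex (del_vertex G v) y &
                  ~ component (del_vertex G v) x y].
Proof.
set H := del_vertex G v; case=> Gv _ nle; apply: contrapT => nsep; apply: nle.
have connected x y : vertex H x -> vertex H y -> component H x y.
  by move=> Hx Hy; apply: contrapT => nxy; apply: nsep; exists x, y.
suff one_component :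
    components H `<=` (fun=> vertex H) @` components G.
  exact: card_le_trans (subset_card_le one_component) (card_image_le _ _).
move=> _ [x Hx <-]; exists (component G v); first by exists v.
apply/seteqP; split=> [y Hy|]; first exact: connected.
exact: component_sub_vertex.
Qed.

End Components.

Section CentralProjections.
Variable R : starRingType.
Implicit Types (a e f g h : R).

Lemma projection_ideal_central e :
  projection e -> (forall r, rmulset e (r * e)) -> central_projection e.
Proof.
move=> [ee se] ideal.
(* Applying [star] to [absorb] yields [e * r * e = e * r]. *)
have absorb r : e * r * e = r * e.
  by have [c _ ec] := ideal r; rewrite -mulrA -ec mulrA ee.
split=> // r; have /(congr1 (@star R)) := absorb (star r).
by rewrite !starM se starK mulrA absorb => ->.
Qed.

Lemma CP_mul e f : CP e -> CP f -> CP (e * f).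
Proof.
move=> [[ee se] ce] [[ff sf] cf]; split; first split.
- by rewrite -mulrA (mulrA f) cf -mulrA ff mulrA ee.
- by rewrite starM se sf ce.
- by move=> r; rewrite -mulrA cf mulrA ce mulrA.
Qed.

Lemma cp_le_refl e : projection e -> cp_le e e.
Proof. by case=> ee _; split. Qed.

Lemma cp_le_trans f e g : cp_le e f -> cp_le f g -> cp_le e g.
Proof.
move=> [ef fe] [fg gf]; split; first by rewrite {2}ef -mulrA -fg.
by rewrite {2}fe mulrA -gf.
Qed.

Lemma cp_le_mull e f : CP e -> cp_le (e * f) e.
Proof. by move=> [[ee _] ce]; split; rewrite -?ce mulrA ee. Qed.

Lemma cp_le_mulr e f : CP f -> cp_le (e * f) f.
Proof. by move=> [[ff _] cf]; split; rewrite ?cf -mulrA ff. Qed.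

Definition cp_below e : set R := [set g | [/\ CP g, g <> 0 & cp_le g e]].

Lemma cp_below_refl e : CP e -> e <> 0 -> cp_below e e.
Proof. by move=> CPe e0; split=> //; apply: cp_le_refl; case: CPe. Qed.

Lemma cp_below_le e f : cp_le e f -> cp_below e `<=` cp_below f.
Proof. by move=> ef g [CPg g0 /cp_le_trans ge]; split=> //; apply: ge. Qed.

Lemma cp_below_orthogonal e f g h :
  e * f = 0 -> cp_below e g -> cp_below f h -> g * h = 0.
Proof.
move=> ef [_ _ [ge _]] [_ _ [_ fh]].
by rewrite ge fh -mulrA (mulrA e) ef mul0r mulr0.
Qed.

Lemma cp_below_sub1_atom e a :
  CP e -> e <> 0 -> cp_below e `<=` [set a] -> cp_atom a.
Proof.
move=> CPe e0 below_a; have <- : e = a by apply: below_a; apply: cp_below_refl.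
split=> // g CPg _ ge; have [->|/eqP g0] := eqVneq g 0; [by left | right].
have -> : g = a by apply: below_a.
by apply/esym/below_a/cp_below_refl.
Qed.

End CentralProjections.

Section StrongZeroDivisors.
Variable R : starRingType.
Implicit Types (b g h x y z : R).

Lemma rmulset_id x : rmulset x x.
Proof. by exists 1; rewrite ?mulr1. Qed.

Lemma rann_rmulsetP x b : rann (rmulset x) b <-> forall r, x * r * b = 0.
Proof.
by split=> [xb r | xb _ [r _ <-]]; [apply: xb; exists r | apply: xb].
Qed.

Lemma rann_rmulset_star x y :
  rann (rmulset x) (star y) -> rann (rmulset y) (star x).
Proof.
move=> /rann_rmulsetP xy; apply/rann_rmulsetP => r; apply: (can_inj starK).
by rewrite star0 !starM starK mulrA.
Qed.

Lemma szd_vertexI x b : x <> 0 -> b <> 0 -> rann (rmulset x) b -> szd_vertex x.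
Proof. by move=> x0 b0 xb; split=> // ann0; apply: b0; rewrite ann0 in xb. Qed.

Lemma szd_edgeI x y :
  x <> 0 -> y <> 0 -> x <> y -> rann (rmulset x) (star y) -> szd_edge x y.
Proof.
have star_neq0 z : z <> 0 -> star z <> 0.
  by move=> z0 sz; apply: z0; rewrite -[z]starK sz star0.
move=> x0 y0 xy ann_xy; split=> //; last exact/rann_rmulsetP.
- exact: szd_vertexI x0 (star_neq0 y y0) ann_xy.
- exact: szd_vertexI y0 (star_neq0 x x0) (rann_rmulset_star ann_xy).
Qed.

Lemma szd_edge_orthogonal g h : central_projection g -> projection h ->
  g <> 0 -> h <> 0 -> g * h = 0 -> szd_edge g h.
Proof.
move=> [[gg _] cg] [_ sh] g0 h0 gh; apply: szd_edgeI => // [eqgh|].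
  by apply: g0; rewrite -gg {2}eqgh.
by apply/rann_rmulsetP => r; rewrite sh cg -mulrA gh mulr0.
Qed.

End StrongZeroDivisors.

Section AnnihilatorProjections.
Variable R : starRingType.
Implicit Types (a e f g h x y : R).

Definition annihilator_projection x e : Prop :=
  central_projection e /\ rann (rmulset x) = rmulset e.

Lemma pq_Baer_annihilator_projection x :
  pq_Baer R -> exists e, annihilator_projection x e.
Proof.
move=> /(_ x)[e pe annx]; exists e; split=> //.
have /rann_rmulsetP xe : rann (rmulset x) e by rewrite annx; apply: rmulset_id.
apply: projection_ideal_central => // r; rewrite -annx.
by apply/rann_rmulsetP => s; rewrite mulrA -(mulrA x).
Qed.

Lemma mul_annihilator_projection x e : annihilator_projection x e -> x * e = 0.
Proof.
move=> [_ annx]; have : rann (rmulset x) e by rewrite annx; apply: rmulset_id.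
by apply; apply: rmulset_id.
Qed.

Lemma annihilator_projection_neq0 x e :
  szd_vertex x -> annihilator_projection x e -> e <> 0.
Proof.
move=> [_ ann_neq0] [_ annx] e0; apply: ann_neq0; rewrite annx e0.
apply/seteqP; split=> [_ [r _ <-]|_ ->]; first by rewrite mul0r.
exact: rmulset_id.
Qed.

Lemma szd_edge_annihilator x e g :
  x <> 0 -> annihilator_projection x e -> cp_below e g -> szd_edge x g.
Proof.
move=> x0 xe [[[_ sg] _] g0 [ge eg]]; apply: szd_edgeI => // [xg|].
  by apply: g0; rewrite ge -xg (mul_annihilator_projection xe).
by rewrite sg xe.2; exists g.
Qed.

Lemma separating_vertex_cp_below a x y e f g h :
  let H := del_vertex (strong_zero_divisor_graph R) a in
  vertex H x -> vertex H y -> ~ component H x y ->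
  annihilator_projection x e -> annihilator_projection y f ->
  cp_below e g -> cp_below f h -> g = h \/ g * h = 0 -> g = a \/ h = a.
Proof.
move=> H [[x0 _] xa] [[y0 _] ya] sep xe yf eg fh gh.
have [->|/eqP ga] := eqVneq g a; [by left | right].
apply: contrapT => ha; apply: sep.
have xg : component H x g.
  by apply: edge_component; split=> //; apply: szd_edge_annihilator eg.
have hy : component H h y.
  apply/component_sym/edge_component.
  by split=> //; apply: szd_edge_annihilator fh.
apply: component_trans xg _; case: gh => [-> // | gh].
apply: component_trans hy; apply: edge_component; split=> //.
by case: eg fh => [CPg g0 _] [[projh _] h0 _]; apply: szd_edge_orthogonal.
Qed.

End AnnihilatorProjections.

Theorem theorem3p4 (R : starRingType) (hR : pq_Baer R) (a : R)
    (ha : cut_vertex (strong_zero_divisor_graph R) a) :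
  central_projection a /\ cp_atom a.
Proof.
suff atom_a : cp_atom a by split=> //; case: atom_a.
have [x [y [Vx Vy sep]]] := cut_vertex_separates ha.
have [e xe] := pq_Baer_annihilator_projection x hR.
have [f yf] := pq_Baer_annihilator_projection y hR.
have e0 : e <> 0 := annihilator_projection_neq0 Vx.1 xe.
have f0 : f <> 0 := annihilator_projection_neq0 Vy.1 yf.
have [[CPe _] [CPf _]] := (xe, yf).
have a_between g h : cp_below e g -> cp_below f h -> g = h \/ g * h = 0 ->
    g = a \/ h = a.
  exact: separating_vertex_cp_below Vx Vy sep xe yf.
have [ef0|/eqP ef_neq0] := eqVneq (e * f) 0.
- have [below_e|/existsNP[g /not_implyP[eg ga]]] :=
    pselect (cp_below e `<=` [set a]).
    exact: cp_below_sub1_atom below_e.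
  apply: (cp_below_sub1_atom CPf f0) => h fh.
  by have [] := a_between g h eg fh (or_intror (cp_below_orthogonal ef0 eg fh)).
- apply: (cp_below_sub1_atom (CP_mul CPe CPf) ef_neq0) => g efg.
  have eg : cp_below e g := cp_below_le (cp_le_mull f CPe) efg.
  have fg : cp_below f g := cp_below_le (cp_le_mulr e CPf) efg.
  by have [] := a_between g g eg fg (or_introl erefl).
Qed.
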